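(* Let $n\ge 3$ be an integer, let $\lambda$, $k$, $m_1,\ldots,m_n$ and $r_1,\ldots,r_k$ be positive integers. Then $\lambda K^3_{m_1,\ldots,m_n}$ is $(r_1,\ldots,r_k)$-factorizable if and only if (i) $m_i=m_j:=m$ for $1\le i<j\le n$, (ii) $3\mid r_i m n$ for each $i$, $1\le i\le k$, and (iii) $\sum_{i=1}^k r_i=\lambda\binom{n-1}{2}m^2$.
   Context: The complete $3$-uniform $n$-partite hypergraph $K^3_{m_1,\ldots,m_n}$ has a vertex set partitioned into parts $V_1,\ldots,V_n$ with $|V_i|=m_i$, and its hyperedges are exactly the $3$-element sets of vertices taken from three different parts (each such set being one hyperedge). For a positive integer $\lambda$, $\lambda\mathscr G$ denotes the multi-hypergraph obtained from $\mathscr G$ by replacing every hyperedge by $\lambda$ parallel copies ($1\mathscr G=\mathscr G$). The degree of a vertex is the number of hyperedges (counted with multiplicity) containing it; a hypergraph is $r$-regular if every vertex has degree $r$. An $r$-factor of $\mathscr G$ is an $r$-regular spanning sub-hypergraph of $\mathscr G$. An $(r_1,\ldots,r_k)$-factorization of $\mathscr G$ is a partition of the collection of hyperedges of $\mathscr G$ into $k$ classes such that, for $i=1,\ldots,k$, the $i$-th class forms an $r_i$-factor of $\mathscr G$; $\mathscr G$ is $(r_1,\ldots,r_k)$-factorizable if it has such a factorization. *)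

(* Defs.v *)
From HB Require Import structures.
From mathcomp Require Import all_boot.

Set Implicit Arguments.
Unset Strict Implicit.
Unset Printing Implicit Defensive.

(* Hyperedges are named, so that distinct parallel hyperedges may have the
   same set of ends. *)
Record multihypergraph := MultiHypergraph {
  vertex : finType;
  hedge : finType;
  ends : hedge -> {set vertex}
}.
Arguments ends : clear implicits.

Definition mdegree (G : multihypergraph) (v : vertex G) : nat :=
  #|[set e : hedge G | v \in ends G e]|.

Definition mregular (r : nat) (G : multihypergraph) : Prop :=
  forall v : vertex G, mdegree v = r.

Definition parallel_copies (lambda : nat) (G : multihypergraph) :=
  @MultiHypergraph (vertex G) (hedge G * 'I_lambda)%type
    (fun e => ends G e.1).

Definition spanning_sub (G : multihypergraph) (F : {set hedge G}) :=
  @MultiHypergraph (vertex G) {e : hedge G | e \in F}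
    (fun e => ends G (val e)).

Definition is_factor (r : nat) (G : multihypergraph) (F : {set hedge G}) :=
  mregular r (spanning_sub F).

Definition factorizable (k : nat) (r : 'I_k -> nat) (G : multihypergraph) :=
  exists F : 'I_k -> {set hedge G},
    [/\ \bigcup_(i < k) F i = [set: hedge G],
        forall i j : 'I_k, i != j -> [disjoint F i & F j]
      & forall i : 'I_k, is_factor (r i) (F i)].

(* A vertex is a pair (i, x) with i the index of its part V_i and x < m i. *)
Definition partite_vertex (n : nat) (m : 'I_n -> nat) : finType :=
  {i : 'I_n & 'I_(m i)}.

Definition is_transversal_triple (n : nat) (m : 'I_n -> nat)
    (e : {set partite_vertex m}) : bool :=
  (#|e| == 3) &&
  [forall u in e, forall v in e, (u != v) ==> (tag u != tag v)].

Definition complete_3uniform_partite (n : nat) (m : 'I_n -> nat) :=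
  @MultiHypergraph (partite_vertex m)
    {e : {set partite_vertex m} | is_transversal_triple e} val.

(* Main.v *)
(* Necessity is double counting. For sufficiency, as in Baranyai's theorem, the
   parts are revealed one at a time. After [t] parts one only records how many
   hyperedges of each colour have a given trace on the revealed vertices. Such
   a hyperedge with trace [S] should meet the next part with probability
   (3 - |S|) / (n - t), which prescribes a rational matrix indexed by traces and
   colours with integral margins; it is rounded to an integral matrix with the
   same margins. This matrix has margins divisible by [m], so it splits into [m]
   integral matrices with equal margins, one for each vertex of the part. *)
Require Import Defs.
From mathcomp Require Import all_boot zify.

Set Implicit Arguments.
Unset Strict Implicit.
Unset Printing Implicit Defensive.

(** * Integral transportation problems with cell capacities *)

Lemma sum_nat_decr (T : finType) (P : pred T) (u : T -> nat) (p0 : T) :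
  0 < u p0 ->
  \sum_(p | P p) u p = \sum_(p | P p) (u p - (p == p0)) + P p0.
Proof.
move=> u0; case: (boolP (P p0)) => P0; last first.
  rewrite addn0; apply: eq_bigr => p Pp.
  by case: eqP => [ep | _]; [rewrite -ep Pp in P0 | rewrite subn0].
rewrite (bigD1 p0) //= [in RHS](bigD1 p0) //= eqxx.
rewrite [in RHS](eq_bigr u) => [|p /andP[_ /negbTE->]]; last by rewrite subn0.
by lia.
Qed.

Lemma sum_nat_setUI (T : finType) (A B : {set T}) (f : T -> nat) :
  \sum_(p in A :&: B) f p + \sum_(p in A :|: B) f p =
  \sum_(p in A) f p + \sum_(p in B) f p.
Proof.
rewrite ![\sum_(p in _) _]big_mkcond -!big_split /=.
by apply: eq_bigr => p _; rewrite !inE; case: (p \in A); case: (p \in B) => /=; lia.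
Qed.

Lemma leq_sum_strict (T : finType) (P Q : pred T) (u : T -> nat) (p0 : T) :
  (forall p, P p -> Q p) -> Q p0 -> ~~ P p0 ->
  \sum_(p | P p) u p + u p0 <= \sum_(p | Q p) u p.
Proof.
move=> PQ Q0 nP0; rewrite [leqRHS](bigD1 p0) //= addnC leq_add2l.
rewrite [leqLHS]big_mkcond [leqRHS]big_mkcond; apply: leq_sum => p _.
have := PQ p; case: (boolP (P p)) => // Pp /(_ isT) ->.
by case: eqP => //= ep; rewrite -ep Pp in nP0.
Qed.

Definition capacity (I J : finType) (u : I * J -> nat)
    (A : {set I}) (B : {set J}) : nat :=
  \sum_(p | (p.1 \in A) && (p.2 \notin B)) u p.

(** Cut condition in the network source, rows, columns, sink, for the cut whose source side is [A]
    and [B]. The rows outside [A] have been cancelled against the total supply. *)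
Definition cut_ok (I J : finType) (u : I * J -> nat) (R : I -> nat)
    (C : J -> nat) (A : {set I}) (B : {set J}) : bool :=
  \sum_(i in A) R i <= \sum_(j in B) C j + capacity u A B.

Lemma sum_pair_row (I J : finType) (y : I * J -> nat) (i0 i : I) (j0 : J) :
  \sum_j (y (i, j) + ((i, j) == (i0, j0))) = \sum_j y (i, j) + (i == i0).
Proof.
rewrite big_split /=; congr addn; rewrite (bigD1 j0) //= big1.
  by rewrite xpair_eqE eqxx andbT addn0.
by move=> j /negbTE nj; rewrite xpair_eqE nj andbF.
Qed.

Lemma sum_pair_col (I J : finType) (y : I * J -> nat) (i0 : I) (j j0 : J) :
  \sum_i (y (i, j) + ((i, j) == (i0, j0))) = \sum_i y (i, j) + (j == j0).
Proof.
rewrite big_split /=; congr addn; rewrite (bigD1 i0) //= big1.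
  by rewrite xpair_eqE eqxx addn0.
by move=> i /negbTE ni; rewrite xpair_eqE ni.
Qed.

(* Max-flow min-cut for transportation problems. A unit of capacity at a cell
   is either deleted or used; if both choices violated a cut, the two violated
   cuts would be tight, and uncrossing them would violate the hypothesis. *)
Lemma transportation (I J : finType) (u : I * J -> nat)
    (R : I -> nat) (C : J -> nat) :
  \sum_i R i = \sum_j C j -> (forall A B, cut_ok u R C A B) ->
  exists y : I * J -> nat,
    [/\ forall p, y p <= u p, forall i, \sum_j y (i, j) = R i
      & forall j, \sum_i y (i, j) = C j].
Proof.
have [N] := ubnP (\sum_p u p); elim: N => // N IH in u R C * => ltN eqRC cuts.
case: (pickP (fun p => 0 < u p)) => [p0 u0 | u0]; last first.
  have {}u0 p : u p = 0 by have := u0 p; case: (u p).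
  have R0 i : R i = 0.
    have := cuts [set i] set0; rewrite /cut_ok big_set1 big_set0.
    by rewrite /capacity big1 // leqn0 => /eqP.
  have C0 j : C j = 0.
    move: eqRC; rewrite big1 => [/esym/eqP|//].
    by rewrite sum_nat_eq0 => /forallP/(_ j)/eqP.
  exists (fun _ => 0); split=> [//|i|j]; rewrite big1 //.
pose u' p := u p - (p == p0).
have ltu' : \sum_p u' p < N.
  by move: ltN; rewrite (sum_nat_decr xpredT u0) addn1 ltnS.
have decU (A : {set I}) (B : {set J}) : capacity u A B =
    capacity u' A B + ((p0.1 \in A) && (p0.2 \notin B)) by exact: sum_nat_decr.
case: (boolP [forall A, [forall B, cut_ok u' R C A B]]) => [ok|].
  case: (IH u' R C) => // [A B|y [yu yR yC]].
    by move/forallP/(_ A)/forallP/(_ B): ok.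
  by exists y; split=> // p; apply: leq_trans (yu p) (leq_subr _ _).
case/forallPn=> A1 /forallPn[B1]; rewrite /cut_ok -ltnNge => viol1.
have := cuts A1 B1; rewrite /cut_ok decU.
case: (boolP (p0.1 \in A1)) => iA1 /=; last by move: viol1; lia.
case: (boolP (p0.2 \in B1)) => jB1 /= cut1; first by move: viol1 cut1; lia.
have {viol1 cut1} tight1 : \sum_(i in A1) R i =
    \sum_(j in B1) C j + capacity u A1 B1.
  by rewrite decU iA1 jB1; move: viol1 cut1; lia.
(* As the first cut is tight, removing the row of [p0] from [A1], or adding its column to [B1],
   loses at least [u p0] of capacity; hence both demands at [p0] are positive and a unit can be
   charged to them. *)
have Rpos : 0 < R p0.1.
  have := cuts (A1 :\ p0.1) B1; rewrite /cut_ok.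
  move: tight1; rewrite (big_setD1 p0.1) //=.
  have : capacity u (A1 :\ p0.1) B1 + u p0 <= capacity u A1 B1.
    apply: leq_sum_strict => [p|/=|/=]; rewrite ?iA1 ?jB1 ?setD11 //.
    by rewrite !inE => /andP[/andP[_ ->] ->].
  by lia.
have Cpos : 0 < C p0.2.
  have := cuts A1 (p0.2 |: B1); rewrite /cut_ok big_setU1 //=.
  have : capacity u A1 (p0.2 |: B1) + u p0 <= capacity u A1 B1.
    apply: leq_sum_strict => [p|/=|/=]; rewrite ?iA1 ?jB1 ?setU11 //.
    by rewrite !inE negb_or => /andP[-> /andP[_ ->]].
  by lia.
pose R' i := R i - (i == p0.1); pose C' j := C j - (j == p0.2).
case: (boolP [forall A, [forall B, cut_ok u' R' C' A B]]) => [ok|].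
  case: (IH u' R' C') => // [|A B|y [yu yR yC]].
  - by move: eqRC; rewrite (sum_nat_decr _ Rpos) (sum_nat_decr _ Cpos) => /addIn.
  - by move/forallP/(_ A)/forallP/(_ B): ok.
  exists (fun p => y p + (p == p0)).
  case: p0 u0 @u' @R' @C' {ltu' decU iA1 jB1 ok} Rpos Cpos yu yR yC
    => i0 j0 /= u0 Rpos Cpos yu yR yC.
  split=> [p|i|j].
  - by have := yu p; case: eqP => [->|_]; lia.
  - by rewrite sum_pair_row yR; case: eqP => [->|_]; lia.
  - by rewrite sum_pair_col yC; case: eqP => [->|_]; lia.
case/forallPn=> A2 /forallPn[B2]; rewrite /cut_ok -ltnNge => viol2.
have decR : \sum_(i in A2) R i = \sum_(i in A2) R' i + (p0.1 \in A2).
  exact: sum_nat_decr.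
have decC : \sum_(j in B2) C j = \sum_(j in B2) C' j + (p0.2 \in B2).
  exact: sum_nat_decr.
have := cuts A2 B2; rewrite /cut_ok => cut2.
move: (decU A2 B2) (decR) (decC).
(* Using the unit can only violate a cut that misses the row of [p0] and contains its column: there
   [C] alone drops, by one, so the cut was tight. *)
case: (boolP (p0.1 \in A2)) => iA2; case: (boolP (p0.2 \in B2)) => jB2 /=;
  [by move: viol2 cut2; lia|by move: viol2 cut2; lia|
  |by move: viol2 cut2; lia].
move=> U2 R2 C2.
have {viol2 cut2 U2 R2 C2 decR decC} tight2 : \sum_(i in A2) R i =
    \sum_(j in B2) C j + capacity u A2 B2 by lia.
have := cuts (A1 :&: A2) (B1 :&: B2); have := cuts (A1 :|: A2) (B1 :|: B2).
rewrite /cut_ok; have := sum_nat_setUI A1 A2 R; have := sum_nat_setUI B1 B2 C.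
(* Capacity is submodular, and [p0] crosses the first cut but neither the union nor the
   intersection, whence the surplus [u p0]. *)
suff : capacity u (A1 :|: A2) (B1 :|: B2) +
       capacity u (A1 :&: A2) (B1 :&: B2) + u p0 <=
       capacity u A1 B1 +
       capacity u A2 B2.
  by move: tight1 tight2; lia.
have -> : u p0 = \sum_(p | p == p0) u p by rewrite big_pred1_eq.
rewrite /capacity ![\sum_(p | _) u p]big_mkcond -!big_split /=; apply: leq_sum => p _.
case: (p =P p0) => [->|_]; rewrite !inE.
  by rewrite iA1 jB2 (negbTE iA2) (negbTE jB1) /=; lia.
case: (p.1 \in A1); case: (p.1 \in A2); case: (p.2 \in B1);
  by case: (p.2 \in B2) => /=; lia.
Qed.

(** * Rounding and splitting of matrices with integral margins *)

(** The fractional matrix [a / D] respects margins and capacities, so every cut condition holds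
    after scaling by [D]. *)
Lemma round_matrix (I J : finType) (a u : I * J -> nat) (D : nat)
    (R : I -> nat) (C : J -> nat) :
  0 < D -> (forall p, a p <= D * u p) ->
  (forall i, \sum_j a (i, j) = D * R i) ->
  (forall j, \sum_i a (i, j) = D * C j) ->
  exists y : I * J -> nat,
    [/\ forall p, y p <= u p, forall i, \sum_j y (i, j) = R i
      & forall j, \sum_i y (i, j) = C j].
Proof.
move=> D0 au aR aC; apply: transportation => [|A B].
  apply/eqP; rewrite -(eqn_pmul2l D0) !big_distrr /=; apply/eqP.
  under eq_bigr do rewrite -aR; under [in RHS]eq_bigr do rewrite -aC.
  exact: exchange_big.
rewrite /cut_ok -(leq_pmul2l D0) mulnDr !big_distrr /=.
under eq_bigr do rewrite -aR; under [X in _ <= X + _]eq_bigr do rewrite -aC.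
rewrite [X in _ <= X + _](exchange_big_dep xpredT) //= !pair_big_dep /=.
rewrite [leqLHS](eq_bigr a) => [|[]//].
rewrite [X in _ <= X + _](eq_bigr a) => [|[]//].
rewrite (bigID (fun p => p.2 \in B)) /=; apply: leq_add;
  rewrite [leqLHS]big_mkcond [leqRHS]big_mkcond; apply: leq_sum => p _;
  by have := au p; do !case: (_ \in _).
Qed.

(** Dividing [y] by [#|P|] gives a fractional matrix below [y] with margins [R] and [C]. Its
    rounding serves one element of [P], and the remainder has margins [#|P| - 1] times [R] and
    [C]. *)
Lemma split_matrix (T I J : finType) (P : {set T}) (y : I * J -> nat)
    (R : I -> nat) (C : J -> nat) :
  (forall i, \sum_j y (i, j) = #|P| * R i) ->
  (forall j, \sum_i y (i, j) = #|P| * C j) ->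
  exists z : T -> I * J -> nat,
    [/\ forall p, \sum_(v in P) z v p = y p,
        forall v i, v \in P -> \sum_j z v (i, j) = R i
      & forall v j, v \in P -> \sum_i z v (i, j) = C j].
Proof.
have [N] := ubnP #|P|; elim: N => // N IH in P y *; rewrite ltnS => leN yR yC.
case: (set_0Vmem P) => [P0|[v0 v0P]].
  exists (fun _ _ => 0); rewrite P0; split=> [[i j]|v i|v j]; rewrite ?inE //.
  rewrite big_set0; apply/esym/eqP; move: (yR i); rewrite P0 cards0 mul0n => /eqP.
  by rewrite sum_nat_eq0 => /forallP/(_ j).
have cP : #|P| = #|P :\ v0|.+1 by rewrite (cardsD1 v0) v0P.
have [||//|//|y0 [y0y y0R y0C]] := @round_matrix I J y y #|P| R C.
- by rewrite cP.
- by move=> p; rewrite cP leq_pmull.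
have [|||z [zy zR zC]] := IH (P :\ v0) (fun p => y p - y0 p).
- by rewrite -cP.
- by move=> i; rewrite sumnB // yR y0R cP mulSn addKn.
- by move=> j; rewrite sumnB // yC y0C cP mulSn addKn.
exists (fun v p => if v == v0 then y0 p else z v p); split=> [p|v i vP|v j vP].
- rewrite (big_setD1 v0) //= eqxx (eq_bigr (fun v => z v p)) => [|v].
    by rewrite zy subnKC.
  by rewrite !inE => /andP[/negbTE->].
- case: eqP => [//|/eqP nv]; by apply: zR; rewrite !inE nv.
- case: eqP => [//|/eqP nv]; by apply: zC; rewrite !inE nv.
Qed.

(** * Traces of transversal triples on the revealed parts *)

(** For the map [tag] this is convertible to the second conjunct of [is_transversal_triple]. *)
Definition transversal (V : finType) (n : nat) (tg : V -> 'I_n)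
    (S : {set V}) : bool :=
  [forall u in S, forall v in S, (u != v) ==> (tg u != tg v)].

Lemma transversalP (V : finType) (n : nat) (tg : V -> 'I_n) (S : {set V}) :
  reflect {in S &, injective tg} (transversal tg S).
Proof.
apply: (iffP forall_inP) => [inj u v uS vS euv|inj u uS].
  have /forall_inP/(_ v vS)/implyP := inj u uS.
  by case: (u =P v) => // _ /(_ isT); rewrite euv eqxx.
apply/forall_inP=> v vS; apply/implyP; apply: contraNneq => euv.
by rewrite (inj u v).
Qed.

(* [S] is a possible trace, on the first [t] parts, of a transversal triple. *)
Definition partial (V : finType) (n : nat) (tg : V -> 'I_n) (t : nat)
    (S : {set V}) : bool :=
  [&& transversal tg S, [forall v in S, tg v < t] & #|S| <= 3].

Lemma partial_setU1 (V : finType) (n : nat) (tg : V -> 'I_n) (t : nat)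
    (S : {set V}) (v : V) :
  partial tg t S -> tg v = t :> nat -> #|S| < 3 ->
  partial tg t.+1 (v |: S) /\ v \notin S.
Proof.
case/and3P=> /transversalP inj /forall_inP lt_t _ tv lt3.
have nvS : v \notin S by apply/negP=> /lt_t; rewrite tv ltnn.
split=> //; apply/and3P; split; last by rewrite cardsU1 nvS.
  apply/transversalP=> a b /setU1P[->|aS] /setU1P[->|bS] // eab.
  - by move: (lt_t b bS); rewrite -eab tv ltnn.
  - by move: (lt_t a aS); rewrite eab tv ltnn.
  - exact: inj.
by apply/forall_inP=> a /setU1P[->|/lt_t/ltnW//]; rewrite tv.
Qed.

Lemma partial_setD1 (V : finType) (n : nat) (tg : V -> 'I_n) (t : nat)
    (S : {set V}) (v : V) :
  partial tg t.+1 S -> tg v = t :> nat -> v \in S ->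
  partial tg t (S :\ v) /\ #|S :\ v| < 3.
Proof.
case/and3P=> /transversalP inj /forall_inP lt_t le3 tv vS.
have lt3 : #|S :\ v| < 3 by move: le3; rewrite (cardsD1 v) vS.
split=> //; apply/and3P; split; last exact: ltnW.
  by apply/transversalP=> a b /setD1P[_ aS] /setD1P[_ bS]; apply: inj.
apply/forall_inP=> a /setD1P[nav aS].
have := lt_t a aS; rewrite ltnS leq_eqVlt => /predU1P[|//].
by rewrite -tv => /val_inj/(inj a v aS vS) eav; rewrite eav eqxx in nav.
Qed.

Lemma partial_mem_row (V : finType) (n : nat) (tg : V -> 'I_n) (t : nat)
    (S : {set V}) (v : V) :
  tg v = t :> nat -> v \in S -> partial tg t S = false.
Proof.
by move=> tv vS; apply/and3P=> -[_ /forall_inP/(_ v vS)]; rewrite tv ltnn.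
Qed.

Lemma partial_avoid_row (V : finType) (n : nat) (tg : V -> 'I_n) (t : nat)
    (S : {set V}) :
  (forall v, v \in S -> tg v != t :> nat) -> partial tg t.+1 S = partial tg t S.
Proof.
move=> avoid; congr [&& _, _ & _]; apply: eq_forallb_in => v vS.
by rewrite ltnS leq_eqVlt (negbTE (avoid v vS)).
Qed.

(* The number of hyperedges of [lambda K^3_{m,...,m}] whose trace on the first
   [t] parts is [S]. *)
Definition completions (V : finType) (n : nat) (tg : V -> 'I_n)
    (lambda m t : nat) (S : {set V}) : nat :=
  partial tg t S * (lambda * m ^ (3 - #|S|) * 'C(n - t, 3 - #|S|)).

(* [x (S, c)] counts the hyperedges of colour [c] whose trace on the first [t]
   parts is [S]. *)
Definition balanced (V : finType) (n k : nat) (tg : V -> 'I_n)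
    (r : 'I_k -> nat) (lambda m t : nat) (x : {set V} * 'I_k -> nat) : Prop :=
  [/\ forall S, \sum_c x (S, c) = completions tg lambda m t S,
      forall c v, tg v < t -> \sum_(S : {set V} | v \in S) x (S, c) = r c
    & forall c, 3 * \sum_S x (S, c) = r c * m * n].

(* The number of hyperedges meeting the first [t] parts in [S] and containing
   a prescribed vertex of the next part. *)
Definition extensions (V : finType) (n : nat) (tg : V -> 'I_n)
    (lambda m t : nat) (S : {set V}) : nat :=
  (partial tg t S && (#|S| < 3)) *
  (lambda * m ^ (2 - #|S|) * 'C(n - t.+1, 2 - #|S|)).

(** A proportion [(3 - #|S|) / (n - t)] of the completions of [S] meets the next part, by the
    absorption identity for binomials; these are shared equally by its [m] vertices. *)
Lemma completions_extensions (V : finType) (n : nat) (tg : V -> 'I_n)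
    (lambda m t : nat) (S : {set V}) :
  t < n ->
  completions tg lambda m t S * (3 - #|S|) =
  (n - t) * (m * extensions tg lambda m t S).
Proof.
move=> lt_tn; rewrite /completions /extensions; case: (partial tg t S);
  rewrite ?muln0 //= mul1n.
have [ge3|lt3] := leqP 3 #|S|; first by rewrite (eqP ge3) !muln0.
rewrite subSn // -(subnSK lt_tn) mul1n expnS.
have := mul_bin_diag (n - t.+1).+1 (2 - #|S|); rewrite /= => bin.
rewrite -mulnA [_ * (_ - _).+1]mulnC -bin.
by rewrite [LHS]mulnCA !mulnA ![_ * m]mulnC !mulnA.
Qed.

(** Pascal's rule: the completions avoiding the next part choose among the [n - t.+1] later ones.
    For [#|S| = 3] the guard in [extensions] makes the subtracted term zero, although [2 - #|S|]
    truncates to 0. *)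
Lemma completions_sub_extensions (V : finType) (n : nat) (tg : V -> 'I_n)
    (lambda m t : nat) (S : {set V}) :
  t < n ->
  completions tg lambda m t S - m * extensions tg lambda m t S =
  partial tg t S * (lambda * m ^ (3 - #|S|) * 'C(n - t.+1, 3 - #|S|)).
Proof.
move=> lt_tn; rewrite /completions /extensions; case pS: (partial tg t S);
  rewrite ?muln0 //= mul1n.
have le3 : #|S| <= 3 by case/and3P: pS.
have [ge3|lt3] := leqP 3 #|S|.
  by rewrite !muln0 subn0 (_ : 3 - #|S| = 0) ?bin0 ?mul1n //; lia.
rewrite subSn // -(subnSK lt_tn) !mul1n binS mulnDr.
by rewrite expnS !mulnA [m * lambda]mulnC addnK.
Qed.

(** * Revealing the parts one at a time *)

Lemma sum_card_mem (V : finType) (f : {set V} -> nat) :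
  \sum_v \sum_(S : {set V} | v \in S) f S = \sum_S f S * #|S|.
Proof.
rewrite (exchange_big_dep xpredT) //=; apply: eq_bigr => S _.
by rewrite sum_nat_const mulnC.
Qed.

Lemma sum_lower_rows (V : finType) (n m t a : nat) (tg : V -> 'I_n) :
  (forall i, #|[set v | tg v == i]| = m) -> t <= n ->
  \sum_(v | tg v < t) a = t * m * a.
Proof.
move=> rows le_tn.
rewrite (partition_big tg (fun i : 'I_n => i < t)) //=.
rewrite (eq_bigr (fun _ => m * a)) => [|i lt_it].
  by rewrite -(big_ord_widen n (fun _ => m * a)) // sum_nat_const card_ord mulnA.
rewrite -(rows i) -sum_nat_const; apply: eq_bigl => v; rewrite inE.
by case: eqP => [->|]; rewrite ?lt_it ?andbF.
Qed.

(** Used for the updated counts: a hyperedge either keeps its trace or gains a vertex [v] of the new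
    part [P], and the sum is regrouped by old trace. *)
Lemma sum_pushforward (V K : finType) (P : {set V})
    (x : {set V} * K -> nat) (z : V -> {set V} * K -> nat)
    (Q : pred {set V}) (c : K) :
  \sum_(S' | Q S') (x (S', c) +
      \sum_(v in P) \sum_(S | v |: S == S') z v (S, c)) =
  \sum_(S | Q S) x (S, c) +
    \sum_(v in P) \sum_(S | Q (v |: S)) z v (S, c).
Proof.
rewrite big_split /=; congr addn; rewrite exchange_big /=.
apply: eq_bigr => v _.
rewrite [RHS](partition_big (fun S => v |: S) Q) //=.
apply: eq_bigr => S' QS'; apply: eq_bigl => S.
by case: eqP => [->|]; rewrite ?QS' ?andbF.
Qed.

Lemma balanced_step (V : finType) (n k : nat) (tg : V -> 'I_n)
    (r : 'I_k -> nat) (lambda m t : nat) (x : {set V} * 'I_k -> nat) :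
  (forall i, #|[set v | tg v == i]| = m) -> t < n ->
  balanced tg r lambda m t x ->
  exists x', balanced tg r lambda m t.+1 x'.
Proof.
move=> rows lt_tn [xR xV xT].
have x0 S c : ~~ partial tg t S -> x (S, c) = 0.
  move=> /negbTE pS; apply/eqP; have := xR S.
  by rewrite /completions pS => /eqP; rewrite sum_nat_eq0 => /forallP/(_ c).
(* [y (S, c)] is the number of hyperedges of colour [c] and trace [S] chosen to meet the next part;
   [n - t] is the denominator of the prescribed probability. *)
have [||||y [yx yR yC]] := @round_matrix _ _ (fun p => x p * (3 - #|p.1|)) x
  (n - t) (fun S => m * extensions tg lambda m t S) (fun c => m * r c).
- by rewrite subn_gt0.
- case=> S c /=; rewrite mulnC.
  (* With fewer parts left than vertices to add, [S] has no completion and [x] vanishes. *)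
  have [le_nt|gt_nt] := leqP (3 - #|S|) (n - t); first exact: leq_mul.
  rewrite (_ : x (S, c) = 0) ?muln0 //; apply/eqP; have := xR S.
  rewrite /completions bin_small // !muln0 => /eqP.
  by rewrite sum_nat_eq0 => /forallP/(_ c).
- by move=> S /=; rewrite -big_distrl /= xR completions_extensions.
- move=> c /=.
  (* Of the [r c * m * n] incidences of colour [c], the revealed parts account for [t * m * r c];
     the difference gives the column margin. *)
  have sum_deg : \sum_S x (S, c) * #|S| = t * m * r c.
    rewrite -(sum_card_mem (fun S => x (S, c))) (bigID (fun v => tg v < t)) /=.
    rewrite (eq_bigr (fun _ => r c)) => [|v lt_vt]; last exact: xV.
    rewrite (sum_lower_rows _ rows) 1?ltnW // big1 ?addn0 // => v ge_vt.
    rewrite big1 // => S vS; apply: x0; apply/and3P=> -[_ /forall_inP/(_ v vS)].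
    by rewrite (negbTE ge_vt).
  have : \sum_S x (S, c) * (3 - #|S|) + \sum_S x (S, c) * #|S| = r c * m * n.
    rewrite -xT -big_split big_distrr /=; apply: eq_bigr => S _.
    rewrite -mulnDr mulnC; case pS: (partial tg t S).
      by case/and3P: pS => _ _ le3; rewrite subnK.
    by rewrite x0 ?pS ?muln0.
  rewrite sum_deg => /(canRL (addnK _)) ->.
  by rewrite mulnBl; congr (_ - _); lia.
pose i0 := Ordinal lt_tn; pose P := [set v | tg v == i0].
have PE v : (v \in P) = (tg v == t :> nat) by rewrite inE.
have [||z [zy zR zC]] := @split_matrix V _ _ P y
  (fun S => extensions tg lambda m t S) r.
- by move=> S; rewrite yR rows.
- by move=> c; rewrite yC rows.
have z0 v S c : v \in P -> ~~ (partial tg t S && (#|S| < 3)) -> z v (S, c) = 0.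
  move=> vP /negbTE pS; apply/eqP; have := zR v S vP.
  by rewrite /extensions pS => /eqP; rewrite sum_nat_eq0 => /forallP/(_ c).
(* The first term counts hyperedges avoiding the new part; [z v] counts those through its vertex
   [v], indexed by their old trace. *)
exists (fun p => (x p - y p) +
  \sum_(v in P) \sum_(S | v |: S == p.1) z v (S, p.2)); split.
- move=> S' /=; rewrite big_split /= sumnB // xR yR completions_sub_extensions //.
  rewrite exchange_big /=.
  under eq_bigr => v vP do (rewrite exchange_big /=;
    under eq_bigr => S _ do rewrite zR //).
  (* If [S'] contains a vertex [v0] of the new part, its only source is [S' :\ v0] extended by [v0];
     otherwise only the unmoved hyperedges contribute. *)
  case: (pickP (fun v => (v \in P) && (v \in S'))) => [v0 /andP[v0P v0S]|no_v].
    have tv0 : tg v0 = t :> nat by apply/eqP; rewrite -PE.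
    rewrite (partial_mem_row tv0 v0S) mul0n add0n.
    case pS': (partial tg t.+1 S'); last first.
      rewrite /completions pS' mul0n big1 // => v vP; rewrite big1 // => S eS.
      rewrite /extensions; case: andP => // -[pS lt3].
      have tv : tg v = t :> nat by apply/eqP; rewrite -PE.
      by have [] := partial_setU1 pS tv lt3; rewrite (eqP eS) pS'.
    have [pS lt3] := partial_setD1 pS' tv0 v0S.
    rewrite (bigD1 v0) //= (bigD1 (S' :\ v0)) /=; last by rewrite setD1K.
    rewrite /completions /extensions pS pS' lt3 /=.
    rewrite [#|S'|](cardsD1 v0) v0S /= subSS.
    rewrite !big1 ?addn0 // => [v /andP[vP nv]|S /andP[/eqP eS nS]].
      rewrite big1 // => S /eqP eS; case/and3P: pS' => /transversalP inj _ _.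
      have vS' : v \in S' by rewrite -eS setU11.
      case/eqP: nv; apply: inj => //; apply: val_inj.
      by apply/eqP; rewrite /= tv0 -PE.
    case: (boolP (v0 \in S)) => v0S1.
      by rewrite (partial_mem_row tv0 v0S1).
    by rewrite -eS setU1K // eqxx in nS.
  have avoid v : v \in S' -> tg v != t :> nat.
    by move=> vS'; rewrite -PE; have := no_v v; rewrite vS' andbT => ->.
  rewrite /completions partial_avoid_row // big1 ?addn0 // => v vP.
  rewrite big1 // => S /eqP eS; have := no_v v.
  by rewrite vP -eS setU11.
- move=> c w lt_wt /=.
  rewrite (sum_pushforward P (fun p => x p - y p) z (fun S' => w \in S') c) /=.
  (* A new vertex has degree given by the column margin of [z w]; at an old vertex the amount [y]
     removed is restored by the sum of the [z v]. *)
  case: (boolP (w \in P)) => wP.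
    have tw : tg w = t :> nat by apply/eqP; rewrite -PE.
    rewrite big1 ?add0n => [|S wS]; last by rewrite x0 // (partial_mem_row tw wS).
    rewrite (bigD1 w) //= [X in _ + X]big1 ?addn0 => [|v /andP[vP nv]].
      by rewrite -(zC w c wP); apply: eq_bigl => S; rewrite setU11.
    rewrite big1 // => S /setU1P[ew|wS]; first by rewrite ew eqxx in nv.
    by rewrite z0 // (partial_mem_row tw wS).
  have lt_w : tg w < t by move: lt_wt; rewrite ltnS leq_eqVlt -PE (negbTE wP).
  rewrite [X in _ + X](_ : _ = \sum_(S : {set V} | w \in S) y (S, c)).
    rewrite -big_split -(xV c w lt_w) /=; apply: eq_bigr => S _.
    exact: subnK.
  under [RHS]eq_bigr do rewrite -zy; rewrite [RHS]exchange_big /=.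
  apply: eq_bigr => v vP; apply: eq_bigl => S; rewrite in_setU1.
  by case: eqP => // ew; rewrite ew vP in wP.
- move=> c; rewrite -xT; congr (_ * _).
  rewrite (sum_pushforward P (fun p => x p - y p) z xpredT c) /=.
  rewrite exchange_big -big_split /=; apply: eq_bigr => S _.
  by rewrite zy subnK.
Qed.

Lemma balanced_exists (V : finType) (n k : nat) (tg : V -> 'I_n)
    (r : 'I_k -> nat) (lambda m t : nat) :
  (forall i, #|[set v | tg v == i]| = m) ->
  (forall c, 3 %| r c * m * n) ->
  \sum_(c < k) r c = lambda * 'C(n - 1, 2) * m ^ 2 ->
  t <= n -> exists x, balanced tg r lambda m t x.
Proof.
move=> rows dvd3 sum_r; elim: t => [_|t IH lt_tn]; last first.
  by have [x bx] := IH (ltnW lt_tn); exact: balanced_step bx.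
(* Initially every trace is empty, and colour [c] must have [r c * m * n / 3] hyperedges, integral
   by hypothesis. Their total is right since [3 'C(n, 3) = n 'C(n - 1, 2)]. *)
exists (fun p => (p.1 == set0) * (r p.2 * m * n %/ 3)); split=> [S||c] //=.
- case: (set_0Vmem S) => [->|[v vS]]; last first.
    rewrite (_ : S == set0 = false) ?big1 //; last first.
      by apply/negbTE/set0Pn; exists v.
    rewrite /completions (_ : partial tg 0 S = false) //.
    by apply/and3P=> -[_ /forall_inP/(_ v vS)].
  rewrite eqxx /completions cards0 (_ : partial tg 0 set0) ?subn0; last first.
    apply/and3P; split; rewrite ?cards0 //.
      by apply/transversalP=> a b; rewrite inE.
    by apply/forall_inP=> a; rewrite inE.
  apply/eqP; rewrite -(eqn_pmul2l (isT : 0 < 3)) big_distrr /=; apply/eqP.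
  rewrite (eq_bigr (fun c => r c * (m * n))) => [|c _]; last first.
    by rewrite mul1n mulnC divnK // mulnA.
  rewrite -big_distrl sum_r /= mul1n [RHS]mulnCA -mul_bin_diag -subn1 !expnS.
  by lia.
- rewrite (bigD1 set0) //= big1 => [|S /negbTE->]; last by rewrite mul0n.
  by rewrite eqxx mul1n addn0 mulnC divnK.
Qed.

(** * Colour counts and degrees in multi-hypergraphs *)

Lemma colouring_with_counts (K : finType) (l : nat) (f : K -> nat) :
  \sum_c f c = l -> exists g : 'I_l -> K, forall c, \sum_i (g i == c) = f c.
Proof.
move=> sum_f; pose s := flatten [seq nseq (f c) c | c <- index_enum K].
have count_s (a : pred K) : count a s = \sum_c a c * f c.
  rewrite count_flatten -map_comp sumnE big_map.
  by apply: eq_bigr => c _; rewrite /= count_nseq.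
have size_s : size s == l.
  by rewrite -(count_predT s) count_s -sum_f; apply/eqP/eq_bigr=> c _; rewrite mul1n.
exists (fun i => tnth (Tuple size_s) i) => c.
rewrite -(big_tuple _ _ (Tuple size_s) xpredT (fun d => nat_of_bool (d == c))) /=.
rewrite -big_mkcond sum1_count count_s (bigD1 c) //= eqxx mul1n big1 ?addn0 //.
by move=> d /negbTE->.
Qed.

Lemma mdegreeE (G : multihypergraph) (v : vertex G) :
  mdegree v = \sum_e (v \in ends G e).
Proof.
by rewrite /mdegree -sum1_card big_mkcond; apply: eq_bigr => e; rewrite inE.
Qed.

Lemma mdegree_spanning_sub (G : multihypergraph) (F : {set hedge G})
    (v : vertex G) :
  @mdegree (spanning_sub F) v = \sum_(e in F) (v \in ends G e).
Proof. by rewrite mdegreeE [RHS]big_sub. Qed.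

Lemma mdegree_parallel_copies (lambda : nat) (G : multihypergraph)
    (v : vertex G) :
  @mdegree (parallel_copies lambda G) v = lambda * mdegree v.
Proof.
rewrite !mdegreeE /= -(pair_bigA _ (fun e _ => nat_of_bool (v \in ends G e))) /=.
rewrite big_distrr; apply: eq_bigr => e _.
by rewrite sum_nat_const card_ord.
Qed.

(** * Degrees in the complete 3-uniform partite hypergraph *)

Lemma sum_partite_vertex (n : nat) (m : 'I_n -> nat) (Q : pred 'I_n)
    (f : 'I_n -> nat) :
  \sum_(v : partite_vertex m | Q (tag v)) f (tag v) = \sum_(i | Q i) m i * f i.
Proof.
rewrite (eq_bigl (fun v : partite_vertex m => Q (tag v) && true)) => [|v]; last first.
  by rewrite andbT.
rewrite -(sig_big_dep Q (fun _ => xpredT) (fun i _ => f i)) /=.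
by apply: eq_bigr => i _; rewrite sum_nat_const card_ord.
Qed.

Lemma card_partite_row (n : nat) (m : 'I_n -> nat) (i : 'I_n) :
  #|[set v : partite_vertex m | tag v == i]| = m i.
Proof.
rewrite -sum1_card (eq_bigl (fun v : partite_vertex m => tag v == i)) => [|v].
  rewrite (sum_partite_vertex m (pred1 i) (fun _ => 1)) big_pred1_eq.
  by rewrite muln1.
by rewrite inE.
Qed.

Lemma transversal_triple_set3 (n : nat) (m : 'I_n -> nat)
    (v u w : partite_vertex m) :
  tag u != tag v -> tag w != tag v -> tag w != tag u ->
  forall S : {set partite_vertex m},
  is_transversal_triple S && (v \in S) && ((u \in S :\ v) && (w \in S :\ v :\ u))
  = (S == [set v; u; w]).
Proof.
move=> uv wv wu S.
have neq_tag (a b : partite_vertex m) : tag a != tag b -> a != b.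
  by apply: contraNneq => ->.
have card3 : #|[set v; u; w]| = 3.
  rewrite setUC cardsU1 cards2 !inE negb_or neq_tag //= neq_tag //=.
  by rewrite eq_sym neq_tag.
apply/idP/eqP=> [|->].
  rewrite !inE => /andP[/andP[/andP[/eqP cS _] vS] /andP[/andP[_ uS]]].
  case/and3P=> _ _ wS; apply/esym/eqP; rewrite eqEcard cS card3 andbT.
  by apply/subsetP=> a /setUP[/set2P[]->|/set1P->].
rewrite !inE !eqxx !orbT !andbT !neq_tag // !andbT /is_transversal_triple card3 /=.
apply/forall_inP=> a /setUP[/set2P[]->|/set1P->];
  apply/forall_inP=> b /setUP[/set2P[]->|/set1P->];
  rewrite ?eqxx //; apply/implyP=> _ //; by rewrite eq_sym.
Qed.

(* Both sides count the ordered pairs [(u, w)] such that [{v, u, w}] is a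
   hyperedge, plus the pairs [(u, w)] lying in a common part other than that
   of [v]. *)
Lemma mdegree_complete (n : nat) (m : 'I_n -> nat) (v : partite_vertex m) :
  2 * @mdegree (complete_3uniform_partite m) v +
    \sum_(j | j != tag v) m j ^ 2 = (\sum_(j | j != tag v) m j) ^ 2.
Proof.
rewrite mdegreeE /=.
rewrite -(big_sub _ (fun S : {set partite_vertex m} => nat_of_bool (v \in S))) /=.
pose pair_in (S : {set partite_vertex m}) p :=
  (p.1 \in S :\ v) && (p.2 \in S :\ v :\ p.1).
pose tags_ok (p : partite_vertex m * partite_vertex m) :=
  [&& tag p.1 != tag v, tag p.2 != tag v & tag p.2 != tag p.1].
(* Each hyperedge through [v] yields two ordered pairs of further ends. *)
have -> : 2 * \sum_(S in @is_transversal_triple n m) (v \in S) =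
    \sum_(S | is_transversal_triple S && (v \in S)) \sum_(p | pair_in S p) 1.
  rewrite big_distrr [RHS]big_mkcondr /=; apply: eq_bigr => S /andP[/eqP cS _].
  case: ifP => [vS|_]; last by rewrite muln0.
  have cv : #|S :\ v| = 2 by move: cS; rewrite (cardsD1 v) vS => -[].
  rewrite muln1 -(pair_big_dep _ (fun u w => w \in S :\ v :\ u) (fun _ _ => 1)) /=.
  rewrite (eq_bigr (fun _ => 1)) ?sum1_card ?cv // => u uS.
  have {}uS : u \in S :\ v by [].
  by rewrite sum1_card; move: cv; rewrite (cardsD1 u) uS => -[].
rewrite (exchange_big_dep tags_ok) /=; last first.
  move=> S [u w] /andP[/andP[_ /transversalP inj] vS] /andP[/= /setD1P[nuv uS]].
  case/setD1P=> nwu /setD1P[nwv wS]; apply/and3P.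
  by split; [move: nuv|move: nwv|move: nwu]; apply: contra_neq; apply: inj.
rewrite (eq_bigr (fun _ => 1)); last first.
  case=> u w /and3P[/= uv wv wu].
  rewrite (eq_bigl (pred1 [set v; u; w])) ?big_pred1_eq // => S.
  exact: transversal_triple_set3.
pose i := tag v.
rewrite -(pair_big_dep (fun u : partite_vertex m => tag u != i)
  (fun u (w : partite_vertex m) => (tag w != i) && (tag w != tag u))
  (fun _ _ => 1)) /=.
under eq_bigr => u _ do rewrite (sum_partite_vertex m
  (fun j => (j != i) && (j != tag u)) (fun _ => 1)).
rewrite (sum_partite_vertex m (fun j => j != i)
  (fun l => \sum_(j | (j != i) && (j != l)) m j * 1)).
rewrite -big_split /= -[RHS]mulnn big_distrl /=.
apply: eq_bigr => j nj; rewrite -mulnn -mulnDr; congr (_ * _).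
by rewrite [RHS](bigD1 j) //= addnC; under eq_bigr do rewrite muln1.
Qed.

Lemma mdegree_complete_const (n m0 : nat) (m : 'I_n -> nat)
    (v : partite_vertex m) :
  (forall i, m i = m0) ->
  @mdegree (complete_3uniform_partite m) v = 'C(n - 1, 2) * m0 ^ 2.
Proof.
move=> mE; apply/eqP; rewrite -(eqn_pmul2l (isT : 0 < 2)); apply/eqP.
have card_others : #|[pred j | j != tag v]| = n - 1.
  by have := cardC1 (tag v); rewrite card_ord subn1.
have := mdegree_complete v.
rewrite !(eq_bigr _ (fun j _ => mE j)) (eq_bigr (fun _ => m0 ^ 2)) => [|j _].
  rewrite !sum_nat_const card_others -mulnn => deg.
  have := mul_bin_diag (n - 1) 1; rewrite bin1 => bin.
  rewrite mulnA -bin; move: deg; rewrite -!mulnn; case: (n - 1) => [|q] /=; nia.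
by rewrite mE.
Qed.

(** With [s] and [q] the sums of [m l] and of [m l ^ 2] over the other parts, a vertex of part [i]
    gives [2d = s^2 - q + 2 s m_j], and one of part [j] the same with [m_i]. As [n >= 3], [s] is
    positive. *)
Lemma mdegree_complete_eq_parts (n : nat) (m : 'I_n -> nat) (d : nat) :
  3 <= n -> (forall i, 0 < m i) ->
  (forall v, @mdegree (complete_3uniform_partite m) v = d) ->
  forall i j, m i = m j.
Proof.
move=> n3 m_gt0 deg i j; case: (i =P j) => [->//|/eqP nij].
have /card_gt0P[l] : 0 < #|[pred l | (l != i) && (l != j)]|.
  have := cardC (pred2 i j); rewrite card2 nij card_ord => cij.
  rewrite -(ltn_add2l 2) addn0 (eq_card (B := [predC pred2 i j])) ?cij // => l.
  by rewrite !inE negb_or.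
rewrite inE => /andP[li lj].
have := mdegree_complete (Tagged (fun i => 'I_(m i)) (Ordinal (m_gt0 i))).
have := mdegree_complete (Tagged (fun i => 'I_(m i)) (Ordinal (m_gt0 j))).
rewrite !deg /=.
rewrite !(bigD1 j (P := fun l => l != i)) 1?eq_sym //=.
rewrite !(bigD1 i (P := fun l => l != j)) //=.
rewrite (eq_bigl (fun l => (l != i) && (l != j))) => [|k]; last exact: andbC.
rewrite [X in (_ + X) ^ 2](eq_bigl (fun l => (l != i) && (l != j))) => [|k].
  have : 0 < \sum_(l | (l != i) && (l != j)) m l.
    by rewrite (bigD1 l) /= ?li // addn_gt0 m_gt0.
  rewrite -!mulnn; set s := \sum_(_ < _ | _) m _; set q := \sum_(_ < _ | _) _ ^ 2.
  by nia.
exact: andbC.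
Qed.

(** * Factors as colour classes, and the factorization criterion *)

Lemma card_hedges_factor (n lambda : nat) (m : 'I_n -> nat) (d : nat)
    (F : {set hedge (parallel_copies lambda (complete_3uniform_partite m))}) :
  is_factor d F -> 3 * #|F| = d * \sum_i m i.
Proof.
move=> regF.
have <- : \sum_(v : partite_vertex m) d = d * \sum_i m i.
  rewrite (sum_partite_vertex m xpredT (fun _ => d)) big_distrr /=.
  by apply: eq_bigr => i _; rewrite mulnC.
rewrite (eq_bigr (fun v : partite_vertex m => \sum_(e in F) (v \in val e.1))); last first.
  by move=> v _; rewrite -(regF v) mdegree_spanning_sub.
rewrite exchange_big /= mulnC -sum_nat_const; apply: eq_bigr => e _.
rewrite -big_mkcond sum1_card; apply/esym/eqP.
by have /andP[] := valP e.1.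
Qed.

(** The [lambda] copies of each triple [S] are coloured so that [x (S, c)] of them get colour [c];
    the colour classes are the factors. *)
Lemma factorizable_of_counts (n lambda k : nat) (m : 'I_n -> nat)
    (r : 'I_k -> nat) (x : {set partite_vertex m} * 'I_k -> nat) :
  (forall S, \sum_c x (S, c) = is_transversal_triple S * lambda) ->
  (forall c v, \sum_(S : {set partite_vertex m} | v \in S) x (S, c) = r c) ->
  factorizable r (parallel_copies lambda (complete_3uniform_partite m)).
Proof.
move=> xR xV.
have /fin_all_exists[col colE] (e : hedge (complete_3uniform_partite m)) :
    exists g : 'I_lambda -> 'I_k, forall c, \sum_l (g l == c) = x (val e, c).
  by apply: colouring_with_counts; rewrite xR (valP e) mul1n.
exists (fun c => [set e | col e.1 e.2 == c]); split=> [|c d ncd|c v].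
- by apply/setP=> e; rewrite inE; apply/bigcupP; exists (col e.1 e.2); rewrite ?inE.
- rewrite disjoint_subset; apply/subsetP=> e; rewrite !inE => /eqP->.
  exact: ncd.
rewrite mdegree_spanning_sub big_mkcond /=.
rewrite (eq_bigr (fun p => (col p.1 p.2 == c) * (v \in val p.1))) => [|p _]; last first.
  by rewrite inE; case: eqP; rewrite ?mul1n.
rewrite -(pair_bigA _ (fun e l => (col e l == c) * (v \in val e))) /=.
under eq_bigr => e _ do rewrite -big_distrl /= colE.
rewrite -(big_sub _ (fun S : {set partite_vertex m} => x (S, c) * (v \in S))) /=.
rewrite -(xV c v) big_mkcond [RHS]big_mkcond; apply: eq_bigr => S _.
case: ifP => [_|/negbT nS]; first by case: (v \in S); rewrite ?muln1 ?muln0.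
case: ifP => // _; apply/esym/eqP; have := xR S.
rewrite (negbTE (nS : ~~ is_transversal_triple S)) mul0n => /eqP.
by rewrite sum_nat_eq0 => /forallP/(_ c).
Qed.

Theorem theorem4p2 (n lambda k : nat) (m : 'I_n -> nat) (r : 'I_k -> nat)
    (hn : 3 <= n) (hlambda : 0 < lambda) (hk : 0 < k)
    (hm : forall i : 'I_n, 0 < m i) (hr : forall j : 'I_k, 0 < r j) :
  factorizable r (parallel_copies lambda (complete_3uniform_partite m)) <->
  exists m0 : nat,
    [/\ forall i : 'I_n, m i = m0,
        forall j : 'I_k, 3 %| r j * m0 * n
      & \sum_(j < k) r j = lambda * 'C(n - 1, 2) * m0 ^ 2].
Proof.
split=> [[F [coverF disjF regF]]|[m0 [mE dvd3 sum_r]]].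
  have deg v : lambda * @mdegree (complete_3uniform_partite m) v = \sum_j r j.
    rewrite -mdegree_parallel_copies mdegreeE.
    under [RHS]eq_bigr do rewrite -(regF _ v) mdegree_spanning_sub.
    rewrite -partition_disjoint_bigcup // coverF.
    by apply: eq_bigl => e; rewrite inE.
  pose i0 := Ordinal (leq_trans (isT : 0 < 3) hn).
  have mE i : m i = m i0.
    apply: (@mdegree_complete_eq_parts n m ((\sum_j r j) %/ lambda)) => // v.
    by rewrite -(deg v) mulKn.
  exists (m i0); split=> // [j|].
    rewrite (_ : _ * n = 3 * #|F j|) ?dvdn_mulr //.
    rewrite (card_hedges_factor (regF j)) (eq_bigr _ (fun i _ => mE i)).
    by rewrite sum_nat_const card_ord mulnA mulnAC.
  rewrite -(deg (Tagged (fun i => 'I_(m i)) (Ordinal (hm i0)))).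
  by rewrite (mdegree_complete_const _ mE) mulnA.
have rows i : #|[set v : partite_vertex m | tag v == i]| = m0.
  by rewrite card_partite_row.
have [x [xR xV _]] := balanced_exists rows dvd3 sum_r (leqnn n).
(* With all parts revealed, ['C(0, 3 - #|S|)] vanishes for [#|S| < 3] and [partial] excludes
   [#|S| > 3], so only transversal triples remain, each with count [lambda]. *)
apply: (@factorizable_of_counts _ _ _ _ _ x) => [S|c v]; last exact: xV.
rewrite xR /completions subnn /partial.
rewrite (_ : [forall v in S, tag v < n]); last by apply/forall_inP.
rewrite /is_transversal_triple; case: (ltngtP 3 #|S|) => [lt3|gt3|eq3].
- by rewrite !andbF.
- by rewrite bin_small ?subn_gt0 // !muln0.
by rewrite -eq3 !andbT expn0 bin0 !muln1.
Qed.
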